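(* For every odd integer $p\ge 5$, the knot complex $\mathrm{CFK}^{\infty}(T(p,p+2))$ is not stably equivalent to the knot complex $\mathrm{CFK}^{\infty}(T(2,p)\,\#\,T(p,p+1))$.
   Context: $T(p,q)\subset S^3$ denotes the torus knot for coprime $p,q\ge 2$, and $\#$ is connected sum of knots. $\mathbb F$ is the field with two elements. **Knot complexes.** For a knot $K\subset S^3$, $\mathrm{CFK}^\infty(K)$ is the Heegaard Floer knot complex of Ozsváth and Szabó. It is a finitely generated free chain complex over $\mathbb F[U,U^{-1}]$ with a Maslov grading, which the boundary map $\partial$ lowers by 1, and with two filtrations, the algebraic filtration $\mathrm{alg}$ and the Alexander filtration $\mathrm{Alex}$, neither of which is raised by $\partial$. Multiplication by $U$ lowers both filtration levels by 1 and the Maslov grading by 2. The complex is well defined up to bifiltered chain homotopy equivalence, denoted $\simeq$: grading-preserving, $\mathbb F[U,U^{-1}]$-linear chain maps respecting both filtrations, which are mutually inverse up to homotopies that also respect both filtrations. **Explicit models (standard facts).** Write the Alexander polynomial of a torus knot $K=T(p,q)$ as $\Delta_K(t)=\frac{(t^{pq}-1)(t-1)}{(t^p-1)(t^q-1)}=\sum_{i=0}^d(-1)^it^{a_i}$ with $0=a_0<a_1<\dots<a_d$ ($d$ even). Then $\mathrm{CFK}^\infty(K)$ is the staircase complex $[a_1-a_0,a_2-a_1,\dots,a_d-a_{d-1}]$. This is the complex freely generated over $\mathbb F[U,U^{-1}]$ by $x_0,\dots,x_d$, where: - $x_0$ has (alg, Alex) level $(0,a_d/2)$; - $x_{2i+1}$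 has the level of $x_{2i}$ plus $(a_{2i+1}-a_{2i},0)$; - $x_{2i+2}$ has the level of $x_{2i+1}$ minus $(0,a_{2i+2}-a_{2i+1})$; - the even-indexed generators have Maslov grading 0 and the odd-indexed ones have Maslov grading 1; - $\partial x_{2i}=0$ and $\partial x_{2i+1}=x_{2i}+x_{2i+2}$. For knots $K,J$, $\mathrm{CFK}^\infty(K\,\#\,J)\simeq \mathrm{CFK}^\infty(K)\otimes_{\mathbb F[U,U^{-1}]}\mathrm{CFK}^\infty(J)$, where filtration levels and gradings add. **Stable equivalence.** $\mathrm{CFK}^\infty(K_1)$ and $\mathrm{CFK}^\infty(K_2)$ are called stably equivalent if there are acyclic complexes $A_1,A_2$ (graded, bifiltered complexes of the same type over $\mathbb F[U,U^{-1}]$ with zero homology) such that $\mathrm{CFK}^\infty(K_1)\oplus A_1\simeq \mathrm{CFK}^\infty(K_2)\oplus A_2$. *)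

(* Defs.v *)
From HB Require Import structures.
From mathcomp Require Import all_boot all_order all_algebra.
From mathcomp Require Import finmap.
From mathcomp Require Import monalg zify.

Set Implicit Arguments.
Unset Strict Implicit.
Unset Printing Implicit Defensive.

Import Order.TTheory GRing.Theory Num.Theory.

Local Open Scope ring_scope.

HB.lock Definition ext (K : choiceType) (V : lmodType 'F_2) (h : K -> V)
    (m : {malg 'F_2[K]}) : V :=
  \sum_(t <- msupp m) m@_t *: h t.

Section LinearExtension.
Variables (K : choiceType) (V : lmodType 'F_2) (h : K -> V).

Local Notation ext := (ext h).

Lemma extEw (d : {fset K}) (m : {malg 'F_2[K]}) :
  (msupp m `<=` d)%fset -> ext m = \sum_(t <- d) m@_t *: h t.
Proof.
move=> le; rewrite unlock (big_fset_incl _ le) // => t _ /mcoeff_outdom ->.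
by rewrite scale0r.
Qed.

Lemma ext_is_linear : linear ext.
Proof.
move=> a m n; pose d := (msupp m `|` msupp n)%fset.
have dm : (msupp m `<=` d)%fset by apply: fsubsetUl.
have dn : (msupp n `<=` d)%fset by apply: fsubsetUr.
have ds : (msupp (a *: m + n) `<=` d)%fset.
  apply: fsubset_trans (msuppD_le _ _) _.
  by rewrite fsubUset dn andbT (fsubset_trans (msuppZ_le _ _)).
rewrite (extEw dm) (extEw dn) (extEw ds) scaler_sumr -big_split /=.
by apply: eq_bigr => t _; rewrite mcoeffD mcoeffZ scalerDl scalerA.
Qed.

HB.instance Definition _ :=
  GRing.isLinear.Build 'F_2 {malg 'F_2[K]} V _ ext ext_is_linear.

Lemma extU t : ext << t >> = h t.
Proof. by rewrite (extEw (msuppU_le (k:=t))) big_seq_fset1 mcoeffUU scale1r. Qed.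

End LinearExtension.

Lemma malg_addmm (K : choiceType) (m : {malg 'F_2[K]}) : m + m = 0.
Proof.
by apply/malgP => k; rewrite mcoeffD mcoeff0; case: (mcoeff k m) => [[|[]]] //= i;
   apply: val_inj.
Qed.

Lemma malg_ind2 (K : choiceType) (P : {malg 'F_2[K]} -> Prop) :
  P 0 -> (forall t m, P m -> P (<< t >> + m)) -> forall m, P m.
Proof.
move=> P0 PD m; rewrite (monalgE m); elim/big_rec: _ => // t n _ Pn.
have [->|->] : m@_t = 0 \/ m@_t = 1.
  by case: (m@_t) => [[|[|//]] i]; [left|right]; apply: val_inj.
  by rewrite monalgU0 add0r.
exact: PD.
Qed.

(* A graded bifiltered free module of finite rank over F[U, U^-1], F = 'F_2,
   given by a basis adapted to the grading and to both filtrations.  As an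
   F-vector space it has the basis of all U^k x, with x in the finite type
   [gen] and k : int; the basis element U^k x is << (x, k) >>. *)
Record bfmod := BFMod {
  gen : finType;
  alg : gen -> int;
  alex : gen -> int;
  maslov : gen -> int
}.

Definition elt (M : bfmod) : lmodType 'F_2 := {malg 'F_2[(gen M * int)%type]}.

(* Locked: unification otherwise unfolds the underlying finite maps, at great
   cost. *)
HB.lock Definition bas (M : bfmod) (x : gen M) (k : int) : elt M := << (x, k) >>.

Lemma ext_bas (M : bfmod) (V : lmodType 'F_2) (h : (gen M * int)%type -> V) x k :
  ext h (bas x k) = h (x, k).
Proof. by rewrite bas.unlock extU. Qed.

Definition msup (M : bfmod) (m : elt M) : {fset gen M * int} := msupp m.

Definition upow (M : bfmod) (n : int) : {linear elt M -> elt M} :=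
  ext (fun t => bas t.1 (t.2 + n)).

Definition homog (M : bfmod) (n : int) (m : elt M) : Prop :=
  forall t, t \in msup m -> maslov t.1 - 2 * t.2 = n.

Definition alg_le (M : bfmod) (i : int) (m : elt M) : Prop :=
  forall t, t \in msup m -> alg t.1 - t.2 <= i.

Definition alex_le (M : bfmod) (j : int) (m : elt M) : Prop :=
  forall t, t \in msup m -> alex t.1 - t.2 <= j.

(* F[U, U^-1]-linear maps that are homogeneous of degree [d] and respect both
   filtrations; as U is invertible, commuting with U suffices. *)
Definition bfmap (d : int) (M N : bfmod) (f : {linear elt M -> elt N}) : Prop :=
  [/\ forall m, f (upow M 1 m) = upow N 1 (f m),
      forall n m, homog n m -> homog (n + d) (f m),
      forall i m, alg_le i m -> alg_le i (f m)
    & forall j m, alex_le j m -> alex_le j (f m)].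

Record complex := Complex {
  cmod :> bfmod;
  bd : {linear elt cmod -> elt cmod};
  bd_bfmap : bfmap (- 1) bd;
  bdK : forall m, bd (bd m) = 0
}.
Arguments bd : clear implicits.

Definition chain_map (C D : complex) (f : {linear elt C -> elt D}) : Prop :=
  bfmap 0 f /\ forall m, f (bd C m) = bd D (f m).

Definition homotopic_id (C : complex) (f : elt C -> elt C) : Prop :=
  exists h : {linear elt C -> elt C},
    bfmap 1 h /\ forall m, f m - m = bd C (h m) + h (bd C m).

Definition htpy_equiv (C D : complex) : Prop :=
  exists (f : {linear elt C -> elt D}) (g : {linear elt D -> elt C}),
    [/\ chain_map f, chain_map g,
        homotopic_id (g \o f) & homotopic_id (f \o g)].

Definition acyclic (C : complex) : Prop :=
  forall m, bd C m = 0 -> exists n, m = bd C n.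

Section UExtension.
Variables M N : bfmod.

Definition uext (f : gen M -> elt N) : {linear elt M -> elt N} :=
  ext (fun t => upow N t.2 (f t.1)).

Lemma upowE n x k : upow M n (bas x k) = bas x (k + n).
Proof. exact: ext_bas. Qed.

Lemma elt_ind (P : elt M -> Prop) :
  P 0 -> (forall x k m, P m -> P (bas x k + m)) -> forall m, P m.
Proof.
move=> P0; rewrite bas.unlock => PD; apply: malg_ind2 => // -[x k]; exact: PD.
 Qed.

Lemma msup_bas (x : gen M) k t : t \in msup (bas x k) -> t = (x, k).
Proof. by rewrite bas.unlock => /(fsubsetP msuppU_le); rewrite in_fset1 => /eqP. Qed.

Lemma msupD (m n : elt M) t : t \in msup (m + n) -> t \in msup m \/ t \in msup n.
Proof. by move/(fsubsetP (msuppD_le _ _)); rewrite in_fsetU => /orP. Qed.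

Lemma msup0 t : t \in msup (0 : elt M) = false.
Proof. by rewrite /msup msupp0 in_fset0. Qed.

End UExtension.

Lemma basE (M : bfmod) (x : gen M) k : bas x k = upow M k (bas x 0).
Proof. by rewrite upowE add0r. Qed.

Lemma upow_upow (M : bfmod) a b (m : elt M) :
  upow M a (upow M b m) = upow M (a + b) m.
Proof.
elim/elt_ind: m => [|x k m IH]; first by rewrite !linear0.
by rewrite !linearD IH !upowE addrAC addrA.
Qed.

Lemma upow0 (M : bfmod) (m : elt M) : upow M 0 m = m.
Proof.
elim/elt_ind: m => [|x k m IH]; first by rewrite !linear0.
by rewrite !linearD IH !upowE addr0.
Qed.

Lemma msup_ext (K : choiceType) (N : bfmod) (h : K -> elt N)
  (m : {malg 'F_2[K]}) t :
  t \in msup (ext h m) -> exists2 s, s \in msupp m & t \in msup (h s).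
Proof.
rewrite unlock big_seq.
pose P (n : elt N) :=
  t \in msup n -> exists2 s, s \in msupp m & t \in msup (h s).
change (P (\sum_(s <- msupp m | s \in msupp m) m@_s *: h s)).
elim/big_ind: _ => [|a b Pa Pb|s sm]; first by rewrite /P msup0.
  by case/msupD=> [/Pa|/Pb].
by move/(fsubsetP (msuppZ_le _ _)) => ts; exists s.
Qed.

Lemma msup_upow (M : bfmod) n (m : elt M) t :
  t \in msup (upow M n m) -> (t.1, t.2 - n) \in msup m.
Proof.
case/msup_ext=> -[x k] xm /msup_bas -> /=.
by rewrite addrK.
Qed.

Lemma uextE (M N : bfmod) (f : gen M -> elt N) x k :
  uext f (bas x k) = upow N k (f x).
Proof. exact: ext_bas. Qed.

Lemma uext_upow (M N : bfmod) (f : gen M -> elt N) n m :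
  uext f (upow M n m) = upow N n (uext f m).
Proof.
elim/elt_ind: m => [|x k m IH]; first by rewrite !linear0.
by rewrite !linearD IH upowE !uextE upow_upow [k + n]addrC.
Qed.

Lemma uext_bfmap (M N : bfmod) d (f : gen M -> elt N) :
  (forall x, [/\ homog (maslov x + d) (f x), alg_le (alg x) (f x)
               & alex_le (alex x) (f x)]) ->
  bfmap d (uext f).
Proof.
move=> H; split.
- by move=> m; rewrite uext_upow.
- move=> n m hm t /msup_ext[[x k] xm /msup_upow tf].
  by case: (H x) => /(_ _ tf) + _ _; move: (hm _ xm) => /=; lia.
- move=> i m hm t /msup_ext[[x k] xm /msup_upow tf].
  by case: (H x) => _ /(_ _ tf) + _; move: (hm _ xm) => /=; lia.
- move=> i m hm t /msup_ext[[x k] xm /msup_upow tf].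
  by case: (H x) => _ _ /(_ _ tf); move: (hm _ xm) => /=; lia.
Qed.

Lemma bd_upow (C : complex) n (m : elt C) :
  bd C (upow C n m) = upow C n (bd C m).
Proof.
have [U1 _ _ _] := bd_bfmap C.
have Un k : forall m, bd C (upow C k%:Z m) = upow C k%:Z (bd C m).
  elim: k => [|k IH] {}m; first by rewrite !upow0.
  have -> : k.+1%:Z = 1 + k%:Z by lia.
  by rewrite -!upow_upow U1 IH.
case: n => k; first exact: Un.
have E l : upow C (Negz k) (upow C k.+1%:Z l) = l.
  by rewrite upow_upow NegzE addNr upow0.
by rewrite -[in RHS](upow0 m) -(subrr k.+1%:Z) -upow_upow Un -NegzE E.
Qed.

Lemma bd_gen (C : complex) (x : gen C) :
  [/\ homog (maslov x - 1) (bd C (bas x 0)), alg_le (alg x) (bd C (bas x 0))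
    & alex_le (alex x) (bd C (bas x 0))].
Proof.
have [_ Hm Ha Hx] := bd_bfmap C.
by split; [apply: Hm|apply: Ha|apply: Hx] => t /msup_bas -> /=;
  rewrite ?mulr0 subr0.
Qed.

Section DirectSum.
Variables C D : complex.

Definition dsum_mod : bfmod := BFMod
  (fun z : gen C + gen D => match z with inl x => alg x | inr y => alg y end)
  (fun z => match z with inl x => alex x | inr y => alex y end)
  (fun z => match z with inl x => maslov x | inr y => maslov y end).

Definition dinl : {linear elt C -> elt dsum_mod} :=
  uext (fun x => bas (inl x : gen dsum_mod) 0).
Definition dinr : {linear elt D -> elt dsum_mod} :=
  uext (fun y => bas (inr y : gen dsum_mod) 0).

Definition dsum_diff (z : gen dsum_mod) : elt dsum_mod :=
  match z with
  | inl x => dinl (bd C (bas x 0))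
  | inr y => dinr (bd D (bas y 0))
  end.

Definition dsum_bd : {linear elt dsum_mod -> elt dsum_mod} := uext dsum_diff.

Lemma dsum_bd_inl m : dsum_bd (dinl m) = dinl (bd C m).
Proof.
elim/elt_ind: m => [|x k m IH]; first by rewrite !linear0.
rewrite !linearD IH; congr (_ + _).
rewrite basE bd_upow /dinl /dinr /dsum_bd !uext_upow; congr (upow _ _ _).
by rewrite [uext _ (bas x 0)]uextE upow0 uextE upow0.
Qed.

Lemma dsum_bd_inr m : dsum_bd (dinr m) = dinr (bd D m).
Proof.
elim/elt_ind: m => [|x k m IH]; first by rewrite !linear0.
rewrite !linearD IH; congr (_ + _).
rewrite basE bd_upow /dinl /dinr /dsum_bd !uext_upow; congr (upow _ _ _).
by rewrite [uext _ (bas x 0)]uextE upow0 uextE upow0.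
Qed.

Lemma dinl_bfmap : bfmap 0 dinl.
Proof.
by apply: uext_bfmap => x; split=> t /msup_bas -> /=; rewrite ?mulr0 ?subr0 ?addr0.
Qed.

Lemma dinr_bfmap : bfmap 0 dinr.
Proof.
by apply: uext_bfmap => x; split=> t /msup_bas -> /=; rewrite ?mulr0 ?subr0 ?addr0.
Qed.

Lemma dsum_bfmap : bfmap (- 1) dsum_bd.
Proof.
apply: uext_bfmap => -[x|y] /=.
  have [_ Hm Ha Hx] := dinl_bfmap; have [gm ga gx] := bd_gen x.
  by split; [rewrite -[_ - 1]addr0; apply: Hm | apply: Ha | apply: Hx].
have [_ Hm Ha Hx] := dinr_bfmap; have [gm ga gx] := bd_gen y.
by split; [rewrite -[_ - 1]addr0; apply: Hm | apply: Ha | apply: Hx].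
Qed.

Lemma dsum_bdK m : dsum_bd (dsum_bd m) = 0.
Proof.
elim/elt_ind: m => [|z k m IH]; first by rewrite !linear0.
rewrite !linearD IH addr0 uextE uext_upow -/dsum_bd.
suff -> : dsum_bd (dsum_diff z) = 0 by rewrite linear0.
by case: z => [x|y]; rewrite /dsum_diff ?dsum_bd_inl ?dsum_bd_inr bdK linear0.
Qed.

Definition dsum : complex := Complex dsum_bfmap dsum_bdK.

End DirectSum.

Definition stably_equiv (C D : complex) : Prop :=
  exists A B : complex,
    [/\ acyclic A, acyclic B & htpy_equiv (dsum C A) (dsum D B)].

Section Tensor.
Variables C D : complex.

(* The tensor product over F[U, U^-1], with basis the x (x) y; by the Kunneth
   formula it is the knot complex of a connected sum. *)
Definition tensor_mod : bfmod := BFMod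
  (fun z : gen C * gen D => alg z.1 + alg z.2)
  (fun z => alex z.1 + alex z.2)
  (fun z => maslov z.1 + maslov z.2).

Definition tens (m : elt C) (n : elt D) : elt tensor_mod :=
  ext (fun s => ext (fun t =>
         bas ((s.1, t.1) : gen tensor_mod) (s.2 + t.2)) n) m.

Definition tensor_diff (z : gen tensor_mod) : elt tensor_mod :=
  let: (x, y) := z in
  tens (bd C (bas x 0)) (bas y 0) + tens (bas x 0) (bd D (bas y 0)).

Definition tensor_bd : {linear elt tensor_mod -> elt tensor_mod} :=
  uext tensor_diff.

Lemma tens0l n : tens 0 n = 0. Proof. exact: linear0. Qed.

Lemma tensDl m1 m2 n : tens (m1 + m2) n = tens m1 n + tens m2 n.
Proof. exact: linearD. Qed.

Lemma tens_basl x k n :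
  tens (bas x k) n =
  ext (fun t => bas ((x, t.1) : gen tensor_mod) (k + t.2)) n.
Proof. exact: ext_bas. Qed.

Lemma tens0r m : tens m 0 = 0.
Proof.
elim/elt_ind: m => [|x k m IH]; first exact: tens0l.
by rewrite tensDl IH addr0 tens_basl linear0.
Qed.

Lemma tensDr m n1 n2 : tens m (n1 + n2) = tens m n1 + tens m n2.
Proof.
elim/elt_ind: m => [|x k m IH]; first by rewrite !tens0l addr0.
by rewrite !tensDl IH !tens_basl linearD addrACA.
Qed.

Lemma tens_bas x k y l :
  tens (bas x k) (bas y l) = bas ((x, y) : gen tensor_mod) (k + l).
Proof. by rewrite tens_basl; apply: ext_bas. Qed.

Lemma tens_upowl a m n : tens (upow C a m) n = upow tensor_mod a (tens m n).
Proof.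
elim/elt_ind: m => [|x k m IH]; first by rewrite linear0 tens0l linear0.
rewrite linearD !tensDl IH linearD; congr (_ + _).
elim/elt_ind: n {IH} => [|y l n IH]; first by rewrite !tens0r linear0.
by rewrite !tensDr IH linearD upowE !tens_bas upowE addrAC.
Qed.

Lemma tens_upowr a m n : tens m (upow D a n) = upow tensor_mod a (tens m n).
Proof.
elim/elt_ind: n => [|x k n IH]; first by rewrite linear0 tens0r linear0.
rewrite linearD !tensDr IH linearD; congr (_ + _).
elim/elt_ind: m {IH} => [|y l m IH]; first by rewrite !tens0l linear0.
by rewrite !tensDl IH linearD upowE !tens_bas upowE addrA.
Qed.

Lemma tensor_bdE m n : tensor_bd (tens m n) = tens (bd C m) n + tens m (bd D n).
Proof.
elim/elt_ind: m => [|x k m IHm].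
  by rewrite !tens0l !linear0 !tens0l addr0.
rewrite !tensDl !linearD !tensDl IHm addrACA; congr (_ + _).
elim/elt_ind: n {IHm} => [|y l n IHn].
  by rewrite !tens0r !linear0 !tens0r addr0.
rewrite !tensDr !linearD !tensDr IHn addrACA; congr (_ + _).
rewrite tens_bas uextE /= linearD.
rewrite (basE x k) (basE y l).
by rewrite !bd_upow !tens_upowl !tens_upowr !upow_upow.
Qed.

Lemma msup_tens m n z : z \in msup (tens m n) ->
  exists s t, [/\ s \in msup m, t \in msup n & z = ((s.1, t.1), s.2 + t.2)].
Proof.
case/msup_ext=> s sm /msup_ext[t tn /msup_bas ->].
by exists s, t.
Qed.

Lemma tensor_bfmap : bfmap (- 1) tensor_bd.
Proof.
apply: uext_bfmap => -[x y] /=.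
have [xm xa xx] := bd_gen x; have [ym ya yx] := bd_gen y.
split=> z /msupD[] /msup_tens[s [t [sm tn ->]]] /=.
- move/msup_bas: tn => -> /=; move: (xm _ sm).
  by move: (maslov s.1) (maslov x) (maslov y) s.2 => a b c k; lia.
- move/msup_bas: sm => -> /=; move: (ym _ tn).
  by move: (maslov t.1) (maslov y) (maslov x) t.2 => a b c k; lia.
- move/msup_bas: tn => -> /=; move: (xa _ sm).
  by move: (alg s.1) (alg x) (alg y) s.2 => a b c k; lia.
- move/msup_bas: sm => -> /=; move: (ya _ tn).
  by move: (alg t.1) (alg y) (alg x) t.2 => a b c k; lia.
- move/msup_bas: tn => -> /=; move: (xx _ sm).
  by move: (alex s.1) (alex x) (alex y) s.2 => a b c k; lia.
- move/msup_bas: sm => -> /=; move: (yx _ tn).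
  by move: (alex t.1) (alex y) (alex x) t.2 => a b c k; lia.
Qed.

Lemma tensor_bdK m : tensor_bd (tensor_bd m) = 0.
Proof.
elim/elt_ind: m => [|[x y] k m IH]; first by rewrite !linear0.
rewrite !linearD IH addr0 -[k]addr0 -tens_bas !tensor_bdE linearD /=.
rewrite !tensor_bdE !bdK tens0l tens0r add0r addr0.
exact: malg_addmm.
Qed.

Definition tensor : complex := Complex tensor_bfmap tensor_bdK.

End Tensor.

Section Staircase.

(* [s] is the list of steps a_1 - a_0, ..., a_d - a_(d-1); as a_0 = 0, the
   exponent a_d is [sumn s], and it is even for the Alexander polynomials used
   below. *)
Variable s : seq nat.

Fixpoint stair_level (i : nat) : int * int :=
  match i with
  | 0 => (0, ((sumn s)./2)%:Z)
  | j.+1 =>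
    let l := stair_level j in
    if odd j then (l.1, l.2 - (nth 0%N s j)%:Z)
    else (l.1 + (nth 0%N s j)%:Z, l.2)
  end.

Definition stair_mod : bfmod := BFMod
  (fun i : 'I_(size s).+1 => (stair_level i).1)
  (fun i => (stair_level i).2)
  (fun i => (odd i)%:Z).

Definition stair_diff (i : gen stair_mod) : elt stair_mod :=
  if odd i
  then \sum_(j < (size s).+1 | (j.+1 == i) || (j == i.+1 :> nat))
         bas (j : gen stair_mod) 0
  else 0.

Definition stair_bd : {linear elt stair_mod -> elt stair_mod} :=
  uext stair_diff.

Lemma stair_diff_sup i t : t \in msup (stair_diff i) ->
  [/\ odd i, ~~ odd t.1, t.2 = 0 & (t.1.+1 == i) || (t.1 == i.+1 :> nat)].
Proof.
rewrite /stair_diff; case: ifP => oi; last by rewrite msup0.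
pose P (m : elt stair_mod) := t \in msup m ->
  [/\ true, ~~ odd t.1, t.2 = 0 & (t.1.+1 == i) || (t.1 == i.+1 :> nat)].
move: t @P => t P.
change (P (\sum_(j < (size s).+1 | (j.+1 == i) || (j == i.+1 :> nat))
         bas (j : gen stair_mod) 0)).
elim/big_ind: _ => [|a b Pa Pb|j ji]; first by rewrite /P msup0.
  by case/msupD=> [/Pa|/Pb].
move/msup_bas => -> /=; split => //.
case/orP: ji => /eqP E; move: oi; first by rewrite -E.
by rewrite E /= negbK.
Qed.

Lemma stair_bfmap : bfmap (- 1) stair_bd.
Proof.
apply: uext_bfmap => i; split=> -[j k] /stair_diff_sup[oi /= ej -> ji].
- by rewrite oi (negbTE ej).
- rewrite subr0; case/orP: ji => /eqP E.
    by rewrite -E /= (negbTE ej) lerDl.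
  by rewrite E /= oi.
- rewrite subr0; case/orP: ji => /eqP E.
    by rewrite -E /= (negbTE ej).
  by rewrite E /= oi gerDl oppr_le0.
Qed.

Lemma stair_bdK m : stair_bd (stair_bd m) = 0.
Proof.
elim/elt_ind: m => [|i k m IH]; first by rewrite !linear0.
rewrite !linearD IH addr0 uextE uext_upow.
suff -> : uext stair_diff (stair_diff i) = 0 by rewrite linear0.
rewrite {2}/stair_diff; case: ifP => oi; last by rewrite linear0.
rewrite linear_sum big1 // => j ji; rewrite uextE /stair_diff.
suff -> : odd j = false by rewrite linear0.
case/orP: ji => /eqP E; first by move: oi; rewrite -E => /negbTE.
by rewrite E /= oi.
Qed.

Definition staircase : complex := Complex stair_bfmap stair_bdK.

End Staircase.

(* The Alexander polynomial of the torus knot T(p, q): the division is exact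
   for coprime p, q >= 2, and the divisor is monic. *)
Definition alexander (p q : nat) : {poly int} :=
  (('X^(p * q) - 1) * ('X - 1)) %/ (('X^p - 1) * ('X^q - 1)).

Definition exponents (P : {poly int}) : seq nat :=
  [seq i <- iota 0 (size P) | P`_i != 0].

Definition steps (a : seq nat) : seq nat :=
  [seq (nth 0 a i.+1 - nth 0 a i)%N | i <- iota 0 (size a).-1].

(* Torus knots are L-space knots, so their knot complex is the staircase of the
   Alexander polynomial (Ozsvath-Szabo). *)
Definition CFK_torus (p q : nat) : complex :=
  staircase (steps (exponents (alexander p q))).

(* Main.v *)
Require Import Defs.
From mathcomp Require Import all_boot all_order all_algebra.
From mathcomp Require Import finmap monalg zify ring.

Set Implicit Arguments.
Unset Strict Implicit.
Unset Printing Implicit Defensive.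

Import Order.TTheory GRing.Theory Num.Theory.

Local Open Scope ring_scope.

(* Write m = (p - 1) / 2 and g = 2 m (m + 1).  A stable equivalence restricts to
   a filtered chain map f from the staircase of T(p, p+2) to the tensor product
   that is injective on homology.  The staircase of T(p, p+2) contains an edge
   x_5, at level (3, g - p), joining x_4 at (2, g - p) to x_6 at
   (3, g - 2 p + 3).  In degree 0, every generator x_i (x) y_j of the tensor
   product with i, j even and level at most that of x_4 has j <= 2, while those
   with level at most that of x_6 have j >= 4.  A path from one family to the
   other must use an edge x_i (x) y_3 with i even, and none of these lies at or
   below the level of x_5.  So the number of generators with j <= 2, modulo 2,
   is 1 on f x_4, 0 on f x_6, and 0 on the boundary of f x_5. *)

(** * Stable equivalence and maps injective on homology *)

(** Degree and filtration bounds are conditions on the support, so this is how they enter the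
    evaluation of a linear map. *)
Lemma eq_on_msup (M : bfmod) (V : lmodType 'F_2) (f g : {linear elt M -> V}) m :
  (forall t, t \in msup m -> f (bas t.1 t.2) = g (bas t.1 t.2)) -> f m = g m.
Proof.
move=> fg; have mE : m = ext (fun t => bas t.1 t.2) m.
  elim/elt_ind: {fg} m => [|x k m IH]; first by rewrite linear0.
  by rewrite linearD /= -IH ext_bas.
rewrite mE ext.unlock !linear_sum big_seq [RHS]big_seq.
by apply: eq_bigr => t /fg fgt; rewrite !linearZ_LR fgt.
Qed.

Lemma elt_addmm (M : bfmod) (m : elt M) : m + m = 0.
Proof. exact: malg_addmm. Qed.

Section Count.
Variables (M : bfmod) (a : pred (gen M)).

(* Ignores the exponent of U, that is, sets U = 1. *)
Definition count_gen : {linear elt M -> ('F_2)^o} := 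
  ext (fun t : (gen M * int)%type => (a t.1)%:R : ('F_2)^o).

Lemma count_bas x k : count_gen (bas x k) = (a x)%:R.
Proof. exact: ext_bas. Qed.

End Count.

Lemma eq_count_gen (M : bfmod) (a b : pred (gen M)) m :
  (forall t, t \in msup m -> a t.1 = b t.1) -> count_gen a m = count_gen b m.
Proof. by move=> ab; apply: eq_on_msup => t /ab; rewrite !count_bas => ->. Qed.

Section DirectSumProjection.
Variables C D : complex.

Definition dproj : {linear elt (dsum C D) -> elt C} :=
  uext (fun z : gen (dsum C D) => if z is inl x then bas x 0 else 0).

Lemma dproj_inl m : dproj (dinl C D m) = m.
Proof.
elim/elt_ind: m => [|x k m IH]; first by rewrite !linear0.
by rewrite !linearD IH [dinl C D _]uextE upowE [dproj _]uextE upowE !add0r.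
Qed.

Lemma dproj_inr m : dproj (dinr C D m) = 0.
Proof.
elim/elt_ind: m => [|x k m IH]; first by rewrite !linear0.
by rewrite !linearD IH [dinr C D _]uextE upowE [dproj _]uextE linear0 add0r.
Qed.

Definition dprojr : {linear elt (dsum C D) -> elt D} :=
  uext (fun z : gen (dsum C D) => if z is inr x then bas x 0 else 0).

Lemma dprojr_inr m : dprojr (dinr C D m) = m.
Proof.
elim/elt_ind: m => [|x k m IH]; first by rewrite !linear0.
by rewrite !linearD IH [dinr C D _]uextE upowE [dprojr _]uextE upowE !add0r.
Qed.

Lemma dprojr_inl m : dprojr (dinl C D m) = 0.
Proof.
elim/elt_ind: m => [|x k m IH]; first by rewrite !linear0.
by rewrite !linearD IH [dinl C D _]uextE upowE [dprojr _]uextE linear0 add0r.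
Qed.

Lemma dsum_decomp (m : elt (dsum C D)) :
  m = dinl C D (dproj m) + dinr C D (dprojr m).
Proof.
elim/elt_ind: m => [|z k m IH]; first by rewrite !linear0 addr0.
rewrite !linearD addrACA -IH; congr (_ + _).
rewrite [dproj _]uextE [dprojr _]uextE.
case: z => x; rewrite linear0 !linear0 ?addr0 ?add0r upowE add0r;
  by rewrite uextE upowE add0r.
Qed.

Lemma dproj_bfmap : bfmap 0 dproj.
Proof.
by apply: uext_bfmap => -[x|y] /=; split=> t;
  rewrite ?msup0 // => /msup_bas -> /=;
  rewrite ?mulr0 ?subr0 ?addr0.
Qed.

Lemma dproj_chain : chain_map dproj.
Proof.
split; first exact: dproj_bfmap.
move=> m; rewrite {1}(dsum_decomp m) linearD /= dsum_bd_inl dsum_bd_inr.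
by rewrite linearD dproj_inl dproj_inr addr0.
Qed.

Lemma dprojr_bd m : dprojr (bd (dsum C D) m) = bd D (dprojr m).
Proof.
rewrite {1}(dsum_decomp m) linearD /= dsum_bd_inl dsum_bd_inr.
by rewrite linearD dprojr_inl dprojr_inr add0r.
Qed.

End DirectSumProjection.

Lemma comp_bfmap d1 d2 (M N P : bfmod) (f : {linear elt M -> elt N})
    (g : {linear elt N -> elt P}) :
  bfmap d1 f -> bfmap d2 g -> bfmap (d1 + d2) (g \o f).
Proof.
case=> fu fh fa fx [gu gh ga gx]; split.
- by move=> m /=; rewrite fu gu.
- by move=> n m /fh/gh /=; rewrite addrA.
- by move=> i m /fa/ga.
- by move=> i m /fx/gx.
Qed.

Lemma comp_chain (C D E : complex) (f : {linear elt C -> elt D})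
    (g : {linear elt D -> elt E}) :
  chain_map f -> chain_map g -> chain_map (g \o f).
Proof.
case=> fb fd [gb gd]; split; last by move=> m /=; rewrite fd gd.
by rewrite -[X in bfmap X](addr0 0); apply: comp_bfmap fb gb.
Qed.

(** The map is inclusion, equivalence, projection. If the D-component of the image of a cycle z
    bounds, then so does the whole image, because B is acyclic. Applying [g] and the homotopy from
    [g \o f] to the identity shows that z itself bounds. *)
Lemma stably_equiv_local_map (C D : complex) : stably_equiv C D ->
  exists f : {linear elt C -> elt D}, chain_map f /\
    forall z, bd C z = 0 -> (exists y, f z = bd D y) -> exists x, z = bd C x.
Proof.
case=> A [B [_ acB [f [g [fc gc [h [_ hE]] _]]]]].
have ic : chain_map (dinl C A : {linear elt C -> elt (dsum C A)}).
  by split; [exact: dinl_bfmap | move=> m /=; rewrite dsum_bd_inl].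
exists (dproj D B \o (f \o dinl C A)).
split; first exact: comp_chain (comp_chain ic fc) (dproj_chain D B).
move=> z zc [y /= yE]; set w := f (dinl C A z) in yE.
have wc : bd (dsum D B) w = 0.
  by rewrite /w -(proj2 fc) -(proj2 ic) zc !linear0.
have [b bE] : exists b, dprojr D B w = bd B b.
  by apply: acB; rewrite -dprojr_bd wc linear0.
pose u : elt (dsum D B) := dinl D B y + dinr D B b.
have wu : w = bd (dsum D B) u.
  by rewrite /u linearD /= dsum_bd_inl dsum_bd_inr -yE -bE -dsum_decomp.
have := hE (dinl C A z); rewrite -(proj2 ic) zc !linear0 addr0 /= -/w wu.
rewrite (proj2 gc) => /eqP; rewrite subr_eq addrC -subr_eq -linearB => /eqP eqz.
exists (dproj C A (g u - h (dinl C A z))).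
by rewrite -(proj2 (dproj_chain C A)) eqz dproj_inl.
Qed.

(** * Homology of staircases and of their tensor products *)

Section StaircaseHomology.
Variable s : seq nat.
Hypothesis s_even : ~~ odd (size s).

Local Notation S := (staircase s).
Local Notation x i k := (bas (inord i : gen S) k).

Lemma odd_gen_lt (i : gen S) : odd i -> (i < size s)%N.
Proof.
move=> oi; rewrite ltn_neqAle -ltnS ltn_ord andbT.
by apply: contraNneq s_even => <-.
Qed.

Lemma stair_bd_even (i : gen S) k : ~~ odd i -> bd S (bas i k) = 0.
Proof. by move=> /negbTE oi; rewrite [LHS]uextE /stair_diff oi linear0. Qed.

(** Both neighbours exist because the last index [size s] is even. The range checks matter: [inord]
    sends an index out of range to 0. *)
Lemma stair_bd_odd (i : gen S) k : odd i ->
  bd S (bas i k) = x i.-1 k + x i.+1 k.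
Proof.
case: i => i ilt oi; have il := odd_gen_lt (i := Ordinal ilt) oi.
rewrite [LHS]uextE /stair_diff oi.
suff -> : \sum_(j < (size s).+1 | (j.+1 == i) || (j == i.+1 :> nat))
    bas (j : gen S) 0 = x i.-1 0 + x i.+1 0 by rewrite linearD !upowE add0r.
rewrite /= in il oi.
have i0 : i.-1.+1 = i by case: i oi {ilt il}.
rewrite (bigD1 (inord i.-1)) /=; last first.
  by rewrite inordK ?i0 ?eqxx // ltnW // i0 ltnW.
rewrite (bigD1 (inord i.+1)) /=; last first.
  rewrite inordK // eqxx orbT /=; apply/eqP => /(congr1 val) /=.
  by rewrite !inordK ?i0 //; lia.
rewrite big1 ?addr0 //.
move=> [j jl] /= /andP[/andP[+ /eqP n1] /eqP n2].
case/orP=> /eqP E; [case: n1|case: n2]; apply: val_inj => /=;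
  by rewrite inordK ?E // -?E //; lia.
Qed.

(** Collapses the staircase onto x_0. Neither this map nor [stair_htpy] has to respect the
    filtrations, since they serve only to compute homology. *)
Definition stair_proj : {linear elt S -> elt S} :=
  uext (fun i : gen S => if odd i then 0 else x 0 0).

(** x_(2n) goes to x_1 + x_3 + ... + x_(2n-1), whose boundary telescopes modulo 2 to x_0 +
    x_(2n). *)
Definition stair_htpy : {linear elt S -> elt S} :=
  uext (fun i : gen S => if odd i then 0 else \sum_(k < i./2) x k.*2.+1 0).

Lemma stair_htpyE (i : gen S) k : stair_htpy (bas i k) =
  if odd i then 0 else \sum_(j < i./2) x j.*2.+1 k.
Proof.
rewrite [LHS]uextE; case: ifP; rewrite ?linear0 // linear_sum => _.
by apply: eq_bigr => j _; rewrite upowE add0r.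
Qed.

Lemma stair_projE (i : gen S) k :
  stair_proj (bas i k) = if odd i then 0 else x 0 k.
Proof. by rewrite [LHS]uextE; case: ifP; rewrite ?linear0 // upowE add0r. Qed.

Lemma stair_bd_sum n k : (n.*2 <= size s)%N ->
  bd S (\sum_(j < n) x j.*2.+1 k) = x 0 k + x n.*2 k.
Proof.
elim: n => [|n IH] nl; first by rewrite big_ord0 linear0 elt_addmm.
rewrite doubleS in nl *.
rewrite big_ord_recr linearD IH /=; last by lia.
rewrite stair_bd_odd inordK ?odd_double ?ltnS //=; try lia.
by rewrite addrA -(addrA (x 0 k)) elt_addmm addr0.
Qed.

Lemma stair_bd_proj m : bd S (stair_proj m) = 0.
Proof.
elim/elt_ind: m => [|i k m IH]; first by rewrite !linear0.
rewrite !linearD IH addr0 stair_projE; case: ifP; rewrite ?linear0 // => _.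
by rewrite stair_bd_even // inordK.
Qed.

Lemma stair_proj_bd m : stair_proj (bd S m) = 0.
Proof.
elim/elt_ind: m => [|i k m IH]; first by rewrite !linear0.
rewrite !linearD IH addr0; have [oi|oi] := boolP (odd i); last first.
  by rewrite stair_bd_even // linear0.
rewrite stair_bd_odd // linearD !stair_projE.
have ilt := ltn_ord i; have ? : (i < size s)%N.
  exact: odd_gen_lt.
rewrite !inordK //; last by lia.
case: {ilt} (nat_of_ord i) oi => //= n; rewrite negbK => on.
by rewrite (negbTE on) elt_addmm.
Qed.

Lemma stair_htpyP m :
  bd S (stair_htpy m) + stair_htpy (bd S m) = m + stair_proj m.
Proof.
elim/elt_ind: m => [|i k m IH]; first by rewrite !linear0 addr0.
rewrite !linearD addrACA IH [RHS]addrACA; congr (_ + _).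
rewrite stair_htpyE stair_projE.
have ilt := ltn_ord i.
have [oi|oi] := boolP (odd i); last first.
  rewrite stair_bd_even // linear0 addr0 stair_bd_sum; last by lia.
  by rewrite even_halfK // inord_val addrC.
have ? : (i < size s)%N.
  exact: odd_gen_lt.
rewrite linear0 add0r addr0 stair_bd_odd // linearD !stair_htpyE.
rewrite !inordK //; last by lia.
have E : odd i.-1 = false by lia.
rewrite E /= oi /=.
have -> : uphalf i = i.-1./2.+1 by lia.
rewrite big_ord_recr addrA elt_addmm add0r /=.
suff -> : inord i.-1./2.*2.+1 = i :> 'I_(size s).+1 by [].
by apply: val_inj; rewrite /= inordK; lia.
Qed.

(** The augmentation at U = 1. It kills boundaries because each odd generator has two even ends. *)
Definition stair_eps : {linear elt S -> ('F_2)^o} :=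
  count_gen (fun i : gen S => ~~ odd i).

Lemma stair_eps_bd m : stair_eps (bd S m) = 0.
Proof.
elim/elt_ind: m => [|i k m IH]; first by rewrite !linear0.
rewrite !linearD IH addr0; have [oi|oi] := boolP (odd i); last first.
  by rewrite stair_bd_even // linear0.
rewrite stair_bd_odd // linearD !count_bas.
have ilt := ltn_ord i; have ? : (i < size s)%N.
  exact: odd_gen_lt.
rewrite !inordK //; last by lia.
case: {ilt} (nat_of_ord i) oi => //= n; rewrite negbK => on.
by rewrite on; apply: val_inj.
Qed.

End StaircaseHomology.

Section TensorMap.
Variables C D : complex.
Implicit Types (f : {linear elt C -> elt C}) (g : {linear elt D -> elt D}).

Definition tens_map f g : {linear elt (tensor C D) -> elt (tensor C D)} :=
  uext (fun z : gen (tensor C D) => tens (f (bas z.1 0)) (g (bas z.2 0))).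

Lemma tens_mapE f g m n :
  (forall k m, f (upow C k m) = upow C k (f m)) ->
  (forall k m, g (upow D k m) = upow D k (g m)) ->
  tens_map f g (tens m n) = tens (f m) (g n).
Proof.
move=> fU gU; elim/elt_ind: m => [|x k m IHm].
  by rewrite !linear0 !tens0l linear0.
rewrite !linearD !tensDl !linearD IHm; congr (_ + _).
elim/elt_ind: n {IHm} => [|y l n IHn].
  by rewrite !linear0 !tens0r linear0.
rewrite !linearD !tensDr !linearD IHn; congr (_ + _).
rewrite tens_bas [LHS]uextE /= (basE x k) (basE y l) fU gU.
by rewrite tens_upowl tens_upowr upow_upow.
Qed.

End TensorMap.

Lemma count_tens (C D : complex) (a : pred (gen C)) (b : pred (gen D)) m n :
  count_gen (fun z : gen (tensor C D) => a z.1 && b z.2) (tens m n) =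
  count_gen a m * count_gen b n.
Proof.
elim/elt_ind: m => [|x k m IHm]; first by rewrite tens0l !linear0 mul0r.
rewrite tensDl !linearD IHm mulrDl; congr (_ + _).
elim/elt_ind: n {IHm} => [|y l n IHn]; first by rewrite tens0r !linear0 mulr0.
rewrite tensDr !linearD IHn mulrDr; congr (_ + _).
by rewrite tens_bas !count_bas -natrM mulnb.
Qed.

Section TensorStaircaseHomology.
Variables s1 s2 : seq nat.
Hypotheses (s1_even : ~~ odd (size s1)) (s2_even : ~~ odd (size s2)).

Local Notation S1 := (staircase s1).
Local Notation S2 := (staircase s2).
Local Notation T := (tensor S1 S2).

(** With h the homotopy and P the projection of each factor, h (x) 1 + P (x) h is the usual homotopy
    between the identity and P (x) P. *)
Definition tensor_htpy : {linear elt T -> elt T} :=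
  tens_map (stair_htpy s1) idfun \+ tens_map (stair_proj s1) (stair_htpy s2).

Definition tensor_proj : {linear elt T -> elt T} :=
  tens_map (stair_proj s1) (stair_proj s2).

Lemma tensor_htpyP m :
  bd T (tensor_htpy m) + tensor_htpy (bd T m) = m + tensor_proj m.
Proof.
have hU (s : seq nat) k m0 : stair_htpy s (upow (staircase s) k m0) =
    upow _ k (stair_htpy s m0).
  exact: uext_upow.
have pU (s : seq nat) k m0 : stair_proj s (upow (staircase s) k m0) =
    upow _ k (stair_proj s m0).
  exact: uext_upow.
have iU (M : bfmod) k m0 : idfun (upow M k m0) = upow _ k (idfun m0) by [].
have bT (m1 : elt S1) (m2 : elt S2) :
    bd T (tens m1 m2) = tens (bd S1 m1) m2 + tens m1 (bd S2 m2).
  exact: tensor_bdE.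
have HE m1 m2 : tensor_htpy (tens m1 m2) =
    tens (stair_htpy s1 m1) m2 + tens (stair_proj s1 m1) (stair_htpy s2 m2).
  have -> : tensor_htpy (tens m1 m2) =
    tens_map (stair_htpy s1) idfun (tens m1 m2) +
    tens_map (stair_proj s1) (stair_htpy s2) (tens m1 m2) by [].
  by rewrite !tens_mapE.
move: tensor_htpy HE => H HE.
elim/elt_ind: m => [|[x y] k m IH]; first by rewrite !linear0 addr0.
rewrite !linearD addrACA IH [RHS]addrACA; congr (_ + _).
rewrite -[k]add0r -tens_bas; move: (bas x 0) (bas y k) => {IH}u v.
rewrite bT linearD !HE linearD !bT tens_mapE //.
rewrite stair_bd_proj // stair_proj_bd // !tens0l add0r.
(* [b] stands for h u (x) bd v, which occurs once in each of the two summands and cancels modulo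
   2. *)
have regroup (a b c d e : elt T) :
    a + b + c + (d + (b + e)) = (a + d) + (c + e).
  rewrite (addrAC a) (addrCA d) [LHS]addrA -(addrA (a + c)).
  by rewrite elt_addmm addr0 addrACA.
rewrite addr0 regroup -tensDl -tensDr !stair_htpyP // tensDl tensDr.
(* The two copies of P u (x) v cancel. *)
rewrite -addrA; congr (_ + _); set a := tens _ v.
by rewrite [LHS]addrA elt_addmm add0r.
Qed.

Definition tensor_eps : {linear elt T -> ('F_2)^o} :=
  count_gen (fun z : gen T => ~~ odd z.1 && ~~ odd z.2).

(** A degree-0 term with both indices even has U-exponent 0, and the projection kills every other
    term, so only multiples of x_0 (x) y_0 remain. *)
Lemma tensor_proj_eps m : homog 0 m ->
  tensor_proj m = tensor_eps m *: bas ((inord 0, inord 0) : gen T) 0.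
Proof.
move=> m0; set o := bas _ 0.
pose L : {linear elt T -> elt T} := ext (fun t : (gen T * int)%type =>
  (~~ odd t.1.1 && ~~ odd t.1.2)%:R *: o).
transitivity (L m); last first.
  elim/elt_ind: m {m0} => [|z k m IH]; first by rewrite !linear0 scale0r.
  by rewrite !linearD IH scalerDl count_bas [L _]ext_bas.
apply: eq_on_msup => -[[x y] k] /m0 mk.
have -> : tensor_proj (bas ((x, y) : gen T) k) =
    upow T k (tens (stair_proj s1 (bas x 0)) (stair_proj s2 (bas y 0))).
  exact: uextE.
have {}mk : (odd x)%:Z + (odd y)%:Z - 2 * k = 0 by exact: mk.
rewrite [L _]ext_bas !stair_projE.
case: (odd x) mk; first by rewrite tens0l linear0 scale0r.
case: (odd y); first by rewrite tens0r linear0 scale0r.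
rewrite scale1r tens_bas upowE !add0r => mk.
by have -> : k = 0 by lia.
Qed.

Lemma tensor_eps0_boundary m :
  homog 0 m -> bd T m = 0 -> tensor_eps m = 0 -> exists n, m = bd T n.
Proof.
move=> m0 mc me; exists (tensor_htpy m).
have := tensor_htpyP m.
by rewrite mc linear0 !addr0 tensor_proj_eps // me scale0r addr0.
Qed.

End TensorStaircaseHomology.

(** * The obstruction *)

Definition level_le (a b : int * int) : bool := (a.1 <= b.1) && (a.2 <= b.2).

Lemma msup_chain_map_bas (C D : complex) (f : {linear elt C -> elt D}) x t :
  chain_map f -> t \in msup (f (bas x 0)) ->
  [/\ maslov t.1 - 2 * t.2 = maslov x, alg t.1 - t.2 <= alg x
    & alex t.1 - t.2 <= alex x].
Proof.
case=> -[_ fh fa fx] _ tf.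
by split; [rewrite -[RHS]addr0; apply: fh tf | apply: fa tf | apply: fx tf];
  move=> u /msup_bas ->; rewrite ?mulr0 subr0.
Qed.

Lemma count0 (M : bfmod) m : count_gen (xpred0 : pred (gen M)) m = 0.
Proof.
elim/elt_ind: m => [|z k m IH]; first by rewrite linear0.
by rewrite linearD IH count_bas addr0.
Qed.

Section Obstruction.
Variables (s s1 s2 : seq nat) (e c : nat).
Hypotheses (s_even : ~~ odd (size s)) (s1_even : ~~ odd (size s1))
  (s2_even : ~~ odd (size s2)).
Hypotheses (e_odd : odd e) (e_lt : (e < size s)%N) (c_odd : odd c).

Local Notation lev i j := (stair_level s1 i + stair_level s2 j).

Hypothesis lev_pred : forall i j, (i <= size s1)%N -> (j <= size s2)%N ->
  ~~ odd i -> ~~ odd j -> level_le (lev i j) (stair_level s e.-1) -> (j < c)%N.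
Hypothesis lev_succ : forall i j, (i <= size s1)%N -> (j <= size s2)%N ->
  ~~ odd i -> ~~ odd j -> level_le (lev i j) (stair_level s e.+1) -> (c < j)%N.
Hypothesis lev_mid : forall i, (i <= size s1)%N -> ~~ odd i ->
  ~~ level_le (lev i c) (stair_level s e).

Local Notation S := (staircase s).
Local Notation S1 := (staircase s1).
Local Notation S2 := (staircase s2).
Local Notation T := (tensor S1 S2).
Local Notation x i := (bas (inord i : gen S) 0).

Let low (j : gen S2) := ~~ odd j && (j < c)%N.

Let phi : {linear elt T -> ('F_2)^o} :=
  count_gen (fun z : gen T => ~~ odd z.1 && low z.2).

(** The two ends of an edge y_j other than y_c lie on the same side of c, so they are counted both
    or not at all. *)
Lemma low_bd (j : gen S2) k :
  j != c :> nat -> count_gen low (bd S2 (bas j k)) = 0.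
Proof.
move=> jc; have [oj|oj] := boolP (odd j); last first.
  by rewrite stair_bd_even // linear0.
rewrite stair_bd_odd // linearD !count_bas /low.
have js := odd_gen_lt s2_even oj; rewrite !inordK //; last by lia.
have -> : ~~ odd j.-1 by lia.
have -> : ~~ odd j.+1 by lia.
have -> : (j.-1 < c)%N = (j.+1 < c)%N by move/eqP: jc; lia.
by case: (j.+1 < c)%N; apply: val_inj.
Qed.

(** Differentiating x_i contributes an even count. Differentiating y_j contributes only if i is
    even, and then [low_bd] applies. *)
Lemma phi_bd (i : gen S1) (j : gen S2) k : odd i || (j != c :> nat) ->
  phi (bd T (bas ((i, j) : gen T) k)) = 0.
Proof.
move=> ij; rewrite -[k]add0r -tens_bas [bd T _]tensor_bdE linearD.
rewrite !(@count_tens S1 S2 (fun i => ~~ odd i) low).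
rewrite [count_gen _ (bd S1 _)](stair_eps_bd s1_even) mul0r add0r count_bas.
by case: (odd i) ij => [|/low_bd ->]; rewrite ?mul0r ?mulr0.
Qed.

(** Here x_e is an edge of S and y_c an edge of S2. The boundary of f x_e is f x_(e-1) + f x_(e+1).
    The three level hypotheses make [phi] nonzero on the first term, zero on the second and zero on
    the boundary. *)
Lemma not_stably_equiv_stair : ~ stably_equiv S T.
Proof.
case/stably_equiv_local_map => f [fc f_inj].
have z1c : bd S (x e.-1) = 0 by rewrite stair_bd_even // inordK //; lia.
have sup i a b k : (i <= size s)%N ->
    (((a, b) : gen T), k) \in msup (f (x i)) ->
    [/\ (odd a)%:Z + (odd b)%:Z - 2 * k = odd i,
        (lev a b).1 - k <= (stair_level s i).1
      & (lev a b).2 - k <= (stair_level s i).2].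
  move=> il /(msup_chain_map_bas fc)[h1 h2 h3].
  have iE : nat_of_ord (inord i : 'I_(size s).+1) = i by rewrite inordK.
  by split; [rewrite -[in RHS]iE | rewrite -[X in stair_level s X]iE..].
(* Otherwise f x_(e-1) would bound, hence x_(e-1) too, although its augmentation is 1. *)
have eps1 : tensor_eps s1 s2 (f (x e.-1)) != 0.
  apply/eqP => /(tensor_eps0_boundary s1_even s2_even)[].
  - move=> [[a b] k] /sup[|+ _ _]; first by lia.
    by have -> : odd e.-1 = false by lia.
  - by rewrite -(proj2 fc) z1c linear0.
  - move=> y fy; have [|w wE] := f_inj _ z1c; first by exists y.
    have := stair_eps_bd s_even w; rewrite -wE count_bas inordK; last by lia.
    by have -> : odd e.-1 = false by lia.
have phi1 : phi (f (x e.-1)) = tensor_eps s1 s2 (f (x e.-1)).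
  apply: eq_count_gen => -[[i j] k] /sup[]; first by lia.
  have -> : odd e.-1 = false by lia.
  rewrite /low; have [//|oi] := boolP (odd i).
  have [//|oj] := boolP (odd j) => /= kE aE xE.
  (* Degree 0 with both indices even forces U-exponent 0, so the levels can be compared without a
     shift. *)
  have k0 : k = 0 by move: kE oi oj; clear; case: (odd i); case: (odd j); lia.
  rewrite k0 !subr0 in aE xE.
  have il : (i <= size s1)%N by rewrite -ltnS ltn_ord.
  have jl : (j <= size s2)%N by rewrite -ltnS ltn_ord.
  by rewrite (lev_pred il jl oi oj) // /level_le aE xE.
have phi2 : phi (f (x e.+1)) = 0.
  transitivity (count_gen (xpred0 : pred (gen T)) (f (x e.+1))).
    apply: eq_count_gen => -[[i j] k] /sup[]; first by lia.
    have -> : odd e.+1 = false by rewrite /= e_odd.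
    rewrite /low; have [//|oi] := boolP (odd i).
    have [//|oj] := boolP (odd j) => /= kE aE xE.
    have k0 : k = 0 by move: kE oi oj; clear; case: (odd i); case: (odd j); lia.
    rewrite k0 !subr0 in aE xE.
    have il : (i <= size s1)%N by rewrite -ltnS ltn_ord.
    have jl : (j <= size s2)%N by rewrite -ltnS ltn_ord.
    apply: negbTE; rewrite -leqNgt ltnW //.
    by rewrite (lev_succ il jl oi oj) // /level_le aE xE.
  exact: count0.
have phie : phi (bd T (f (x e))) = 0.
  transitivity (count_gen (xpred0 : pred (gen T)) (f (x e))); last first.
    exact: count0.
  apply: (@eq_on_msup _ _ (phi \o bd T)) => -[[i j] k] /sup[]; first by lia.
  rewrite count_bas [LHS]/= => kE aE xE.
  apply: phi_bd; have [//|oi] := boolP (odd i); apply/eqP => /= jc.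
  move: kE aE xE; rewrite /= jc e_odd c_odd (negbTE oi) => kE.
  (* Degree 1 with i even and j = c odd again leaves only U-exponent 0. *)
  have -> : k = 0 by move: kE; clear; lia.
  rewrite !subr0 => aE xE.
  have il : (i <= size s1)%N by rewrite -ltnS ltn_ord.
  by have := lev_mid il oi; rewrite /level_le aE xE.
have := phie; rewrite -(proj2 fc) stair_bd_odd ?inordK //; try by lia.
by rewrite !linearD phi2 addr0 phi1 => /eqP; rewrite (negbTE eps1).
Qed.

End Obstruction.

(** * Alexander polynomials of torus knots *)

Definition sumX (s : seq nat) : {poly int} := \sum_(n <- s) 'X^n.

Lemma coef_sumX s n : (sumX s)`_n = (count_mem n s)%:R.
Proof.
rewrite /sumX coef_sum; elim: s => [|k s IH]; first by rewrite big_nil.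
by rewrite big_cons IH coefXn natrD eq_sym.
Qed.

Lemma sumX_geometric d c n :
  sumX [seq i * d + c | i <- iota 0 n]%N * ('X^d - 1) = 'X^c * ('X^(n * d) - 1).
Proof.
rewrite /sumX; elim: n => [|n IH]; first by rewrite big_nil mul0r subrr mulr0.
rewrite -[in iota _ _]addn1 iotaD map_cat big_cat /= big_seq1 mulrDl IH add0n.
by rewrite mulSn !exprD; ring.
Qed.

Lemma sumX_allpairs (f g : nat -> nat) s t :
  sumX [seq f i + g j | i <- s, j <- t]%N =
  sumX [seq f i | i <- s] * sumX [seq g j | j <- t].
Proof.
rewrite /sumX big_allpairs_dep !big_map mulr_suml; apply: eq_bigr => i _.
by rewrite mulr_sumr; apply: eq_bigr => j _; rewrite exprD.
Qed.

Lemma mem_exponents P n : (n \in exponents P) = (P`_n != 0).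
Proof.
rewrite mem_filter mem_iota add0n /= andb_idr // => Pn.
by rewrite ltnNge; apply: contra Pn => /(nth_default 0) ->.
Qed.

Lemma exponents_sorted P : sorted ltn (exponents P).
Proof. exact/sorted_filter/iota_ltn_sorted/ltn_trans. Qed.

(** As the entries of [s ++ t] are distinct, no terms cancel and every coefficient is 1, -1 or 0. *)
Lemma exponents_sumXB s t :
  uniq (s ++ t) -> exponents (sumX s - sumX t) =i s ++ t.
Proof.
rewrite cat_uniq => /and3P[us /hasPn st ut] n.
rewrite mem_exponents coefB !coef_sumX !count_uniq_mem // mem_cat.
by move: (st n); case: (n \in t); case: (n \in s) => //= /(_ isT).
Qed.

Lemma size_exponents_sumXB s t : uniq (s ++ t) ->
  size (exponents (sumX s - sumX t)) = (size s + size t)%N.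
Proof.
move=> u; rewrite -size_cat; apply: perm_size; apply: uniq_perm => //.
  exact: (sorted_uniq ltn_trans ltnn (exponents_sorted _)).
exact: exponents_sumXB.
Qed.

(** The divisor is monic, so the product identity determines the quotient, and a closed form can be
    verified by multiplying out. *)
Lemma alexanderE p q P : (0 < p)%N -> (0 < q)%N ->
  P * (('X^p - 1) * ('X^q - 1)) = ('X^(p * q) - 1) * ('X - 1) ->
  alexander p q = P.
Proof.
move=> p0 q0 E; rewrite /alexander -E Pdiv.IdomainMonic.mulpK //.
by rewrite monicMl monicXnsubC.
Qed.

(** * Steps and initial segments of a sorted list of exponents *)

Section SortedSteps.
Variable a : seq nat.
Hypothesis a_sorted : sorted ltn a.

Lemma size_steps : size (steps a) = (size a).-1.
Proof. by rewrite size_map size_iota. Qed.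

Lemma nth_steps i : (i < (size a).-1)%N ->
  nth 0%N (steps a) i = (nth 0 a i.+1 - nth 0 a i)%N.
Proof. by move=> ia; rewrite (nth_map 0%N) ?size_iota // nth_iota. Qed.

Lemma sumn_steps : sumn (steps a) = (last 0 a - head 0 a)%N.
Proof.
rewrite /steps sumnE big_map -nth_last -nth0.
rewrite -[X in iota 0 X]subn0 -/(index_iota 0 _).
rewrite telescope_sumn_in // => i /andP[_ ia].
by apply/ltnW/(sorted_ltn_nth ltn_trans) => //; rewrite inE; lia.
Qed.

Lemma sorted_last M : M \in a -> {in a, forall n, (n <= M)%N} -> last 0%N a = M.
Proof.
move=> Ma aM; apply/eqP; rewrite eqn_leq; apply/andP; split.
  by apply: aM; case: a Ma => // n s _; apply: mem_last.
rewrite -nth_last -{1}(nth_index 0%N Ma).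
have iM : (index M a < size a)%N by rewrite index_mem.
apply: (sorted_leq_nth leq_trans leqnn); rewrite ?inE; try lia.
exact: sub_sorted ltnW _ a_sorted.
Qed.

(** Lets the first exponents be found by testing membership only up to [c]; the remainder consists
    of the entries above [c]. *)
Lemma sorted_prefix r c : sorted ltn r ->
  (forall n, (n \in r) = (n \in a) && (n <= c)%N) -> exists b, a = r ++ b.
Proof.
move=> r_sorted rE; exists [seq n <- a | c < n]%N.
apply: (irr_sorted_eq ltn_trans ltnn a_sorted).
  rewrite sorted_pairwise; last exact: ltn_trans.
  rewrite pairwise_cat -!sorted_pairwise ?r_sorted ?sorted_filter //;
    try exact: ltn_trans.
  rewrite !andbT; apply/allrelP => i j; rewrite rE mem_filter.
  by move=> /andP[_ ic] /andP[+ _]; apply: leq_ltn_trans.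
by move=> n; rewrite mem_cat rE mem_filter; case: (n \in a) => //=;
  case: ltnP; lia.
Qed.

End SortedSteps.

Lemma nth_steps_cat r b i : (i.+1 < size r)%N ->
  nth 0%N (steps (r ++ b)) i = (nth 0 r i.+1 - nth 0 r i)%N.
Proof.
move=> ir; rewrite nth_steps; last by rewrite size_cat; lia.
by rewrite !nth_cat ir ltnW.
Qed.

Lemma eq_divmod p a b a' b' : (b < p)%N -> (b' < p)%N ->
  (a * p + b = a' * p + b')%N -> a = a' /\ b = b'.
Proof.
move=> bp b'p E; have bb : b = b'.
  by have := congr1 (modn^~ p) E; rewrite !modnMDl !modn_small.
split=> //; move: E; rewrite bb => /addIn/eqP.
by rewrite eqn_pmul2r ?(leq_trans _ bp) // => /eqP.
Qed.

Lemma mem_progression d c n k :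
  reflect (exists2 i, (i < n)%N & k = i * d + c)%N
    (k \in [seq i * d + c | i <- iota 0 n]%N).
Proof.
by apply: (iffP mapP) => -[i]; rewrite ?mem_iota => ? ->;
  exists i; rewrite ?mem_iota.
Qed.

Lemma progression_uniq d c n : (0 < d)%N ->
  uniq [seq i * d + c | i <- iota 0 n]%N.
Proof.
move=> d0; rewrite map_inj_uniq ?iota_uniq // => i j /addIn/eqP.
by rewrite eqn_pmul2r // => /eqP.
Qed.

(** * The torus knot T(2, p) for odd p *)

Section TwoStrand.
Variables m p : nat.
Hypothesis pE : p = m.*2.+1.

(** The quotient simplifies to (X^p + 1) / (X + 1), an alternating geometric sum. *)
Lemma alexander_2_odd : alexander 2 p =
  sumX [seq i * 2 + 0 | i <- iota 0 m.+1]%N -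
  sumX [seq i * 2 + 1 | i <- iota 0 m]%N.
Proof.
apply: alexanderE => //; first by rewrite pE.
rewrite mulrA mulrBl !sumX_geometric expr0 expr1.
have -> : (m.+1 * 2 = 1 + p)%N by lia.
have -> : (2 * p = p + p)%N by lia.
have XpE : 'X^p = 'X * 'X^(m * 2) :> {poly int}.
  by rewrite -exprS; congr (_ ^+ _); lia.
by rewrite !exprD XpE; ring.
Qed.

Lemma steps_2_odd : steps (exponents (alexander 2 p)) = nseq m.*2 1%N.
Proof.
have -> : exponents (alexander 2 p) = iota 0 p.
  apply: (irr_sorted_eq ltn_trans ltnn);
    rewrite ?exponents_sorted ?iota_ltn_sorted // => n.
  rewrite alexander_2_odd exponents_sumXB ?mem_cat ?mem_iota ?leq0n ?add0n ?andTb.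
    apply/orP/idP => [[]/mem_progression[i]|np]; try lia.
    have := odd_double_half n; case: (odd n) => nE; [right|left];
      by apply/mem_progression; exists n./2; lia.
  rewrite cat_uniq !progression_uniq // andbT andTb; apply/hasPn => k.
  by move=> /mem_progression[i _ ->]; apply/mem_progression => -[j _]; lia.
rewrite pE; apply: (@eq_from_nth _ 0%N);
  rewrite size_steps ?size_nseq ?size_iota // => i im.
by rewrite nth_steps ?size_iota // !nth_iota ?nth_nseq ?im; lia.
Qed.

End TwoStrand.

(** * The torus knot T(p, p + 1) *)

Section ConsecutiveStrands.
Variable p : nat.
Hypothesis p3 : (3 <= p)%N.

Let s := [seq i * p + 0 | i <- iota 0 p]%N.
Let t := [seq i * p.+1 + 1 | i <- iota 0 p.-1]%N.

Lemma alexander_succ : alexander p p.+1 = sumX s - sumX t.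
Proof.
apply: alexanderE => //; first by lia.
have regroup (S T A B : {poly int}) : (S - T) * (A * B) = S * A * B - T * B * A.
  by ring.
rewrite regroup !sumX_geometric expr0 expr1.
(* All exponents are written through 1, p and (p - 1) (p + 1), which leaves [ring] an identity in
   three powers of X. *)
have -> : (p * p = 1 + p.-1 * p.+1)%N by nia.
have -> : (p * p.+1 = 1 + (p.-1 * p.+1 + p))%N by nia.
by rewrite !exprD (exprS _ p) expr1; ring.
Qed.

Lemma alexander_succ_uniq : uniq (s ++ t).
Proof.
rewrite cat_uniq !progression_uniq ?andbT ?andTb; try lia; apply/hasPn => k.
move=> /mem_progression[i ip ->]; apply/mem_progression => -[j jp].
(* Modulo p this is i + 1, strictly between 0 and p, while the positive exponents are multiples of
   p. *)
have -> : (i * p.+1 + 1 = i * p + i.+1)%N by lia.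
by case/eq_divmod; lia.
Qed.

Let a := exponents (alexander p p.+1).

Lemma le_exponents_succ n : n \in a -> (n <= p.-1 * p)%N.
Proof.
rewrite /a alexander_succ exponents_sumXB ?alexander_succ_uniq // mem_cat.
by case/orP=> /mem_progression[i ip ->]; nia.
Qed.

Lemma size_steps_succ : size (steps a) = (p.-1).*2.
Proof.
rewrite size_steps /a alexander_succ.
rewrite size_exponents_sumXB ?alexander_succ_uniq //.
by rewrite !size_map !size_iota; lia.
Qed.

Lemma exponents_succ_prefix : exists b, a = [:: 0; 1; p; p.+2; 2 * p]%N ++ b.
Proof.
apply: (@sorted_prefix _ _ _ (2 * p)); rewrite ?exponents_sorted //=.
  by lia.
move=> n; rewrite /a alexander_succ exponents_sumXB ?alexander_succ_uniq //.
rewrite mem_cat.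
apply/idP/andP.
  rewrite !inE => /or4P[||| /orP[]] /eqP->; (split; [apply/orP|lia]).
  - by left; apply/mem_progression; exists 0%N; lia.
  - by right; apply/mem_progression; exists 0%N; lia.
  - by left; apply/mem_progression; exists 1%N; lia.
  - by right; apply/mem_progression; exists 1%N; lia.
  - by left; apply/mem_progression; exists 2%N; lia.
case=> /orP[] /mem_progression[i ip ->] np; rewrite !inE.
  have : (i <= 2)%N by nia.
  by case: i {ip} np => [|[|[|]]] //; lia.
have : (i <= 1)%N by nia. by case: i {ip} np => [|[|]] //; lia.
Qed.

End ConsecutiveStrands.

(** * The torus knot T(p, p + 2) for odd p *)

Section OddStrands.
Variables m p : nat.
Hypotheses (m2 : (2 <= m)%N) (pE : p = m.*2.+1).

Let s := [seq (i * p + 0) + (j * p.+2 + 0) |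
  i <- iota 0 m.+1, j <- iota 0 m.+1]%N.
Let t := [seq (i * p + 1) + (j * p.+2 + 0) |
  i <- iota 0 m.+2, j <- iota 0 m]%N.

(* For q = p + 2 one has (p - 1) (q - 1) = m p + m q; this is the closed form of
   Lam and Leung, in which the negative terms carry the exponent
   (m + 1) p + (m + 1) q - p q = 1. *)
Lemma alexander_odd_add2 : alexander p p.+2 = sumX s - sumX t.
Proof.
apply: alexanderE => //; first by lia.
rewrite !(sumX_allpairs (fun i => _ * _ + _)%N (fun j => _ * _ + _)%N).
have regroup (S S' T T' A B : {poly int}) :
  (S * S' - T * T') * (A * B) = S * A * (S' * B) - T * A * (T' * B) by ring.
rewrite regroup !sumX_geometric expr0 expr1.
(* Since p = 2 m + 1, all powers become products of X, X^(m (p + 2)) and X^((m + 2) p). *)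
have -> : (p * p.+2 = 1 + m * p.+2 + m.+2 * p)%N by nia.
have -> : (m.+1 * p = 1 + m * p.+2)%N by nia.
have -> : (m.+1 * p.+2 = 1 + m.+2 * p)%N by nia.
by rewrite !exprD expr1; ring.
Qed.

Lemma mem_posP n :
  reflect (exists i j, [/\ i <= m, j <= m & n = i * p + j * p.+2])%N (n \in s).
Proof.
apply: (iffP allpairsP) => [[[i j]]|[i [j [im jm ->]]]].
  by rewrite !mem_iota /= => -[im jm ->]; exists i, j; split; lia.
by exists (i, j); rewrite !mem_iota /=; split; lia.
Qed.

Lemma mem_negP n :
  reflect
    (exists i j, [/\ i <= m.+1, j < m & n = (i * p + j * p.+2).+1])%N (n \in t).
Proof.
apply: (iffP allpairsP) => [[[i j]]|[i [j [im jm ->]]]].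
  by rewrite !mem_iota /= => -[im jm ->]; exists i, j; split; lia.
by exists (i, j); rewrite !mem_iota /=; split; lia.
Qed.

(* Modulo p, the exponent i p + j (p + 2) is 2 j, and 2 j < p. *)
Lemma lattice_inj c i j i' j' : (j * 2 + c < p)%N -> (j' * 2 + c < p)%N ->
  (i * p + c + (j * p.+2 + 0) = i' * p + c + (j' * p.+2 + 0))%N ->
  (i, j) = (i', j').
Proof.
move=> jp jp' E.
have [] := @eq_divmod p (i + j) (j * 2 + c) (i' + j') (j' * 2 + c) jp jp'.
  by nia.
by move=> ? ?; congr pair; lia.
Qed.

Lemma alexander_odd_add2_uniq : uniq (s ++ t).
Proof.
rewrite cat_uniq; apply/and3P; split.
- apply: allpairs_uniq; rewrite ?iota_uniq // => -[i j] [i' j'].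
  move=> /allpairsP[[? ?] [+ + [-> ->]]] /allpairsP[[? ?] [+ + [-> ->]]].
  by rewrite !mem_iota /= => ? ? ? ? /lattice_inj; apply; lia.
- apply/hasPn => k /mem_negP[i [j [im jm ->]]].
  apply/mem_posP => -[i' [j' [im' jm']]].
  move=> ijE.
  (* Modulo p the negative terms have odd residues 2 j + 1 and the positive ones even residues 2 j',
     all below p. *)
  have E : ((i + j) * p + (j * 2).+1 = (i' + j') * p + j' * 2)%N by nia.
  by case/eq_divmod: E; lia.
- apply: allpairs_uniq; rewrite ?iota_uniq // => -[i j] [i' j'].
  move=> /allpairsP[[? ?] [+ + [-> ->]]] /allpairsP[[? ?] [+ + [-> ->]]].
  by rewrite !mem_iota /= => ? ? ? ? /lattice_inj; apply; lia.
Qed.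

Let a := exponents (alexander p p.+2).

Lemma mem_exponents_odd_add2 n : (n \in a) = (n \in s) || (n \in t).
Proof.
rewrite /a alexander_odd_add2 exponents_sumXB ?alexander_odd_add2_uniq //.
by rewrite mem_cat.
Qed.

Lemma size_steps_odd_add2 : size (steps a) = (m * m.+2).*2.
Proof.
rewrite size_steps /a alexander_odd_add2.
rewrite size_exponents_sumXB ?alexander_odd_add2_uniq //.
by rewrite !size_allpairs !size_iota; nia.
Qed.

Lemma last_exponents_odd_add2 : last 0%N a = (m * m.+1).*2.*2.
Proof.
apply: sorted_last; first exact: exponents_sorted.
  rewrite mem_exponents_odd_add2; apply/orP; left.
  by apply/mem_posP; exists m, m; split; nia.
move=> n; rewrite mem_exponents_odd_add2.
by case/orP=> [/mem_posP[i [j [im jm ->]]]|/mem_negP[i [j [im jm ->]]]]; nia.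
Qed.

Lemma exponents_odd_add2_prefix :
  exists b, a = [:: 0; 1; p; p.+1; p.+2; p.+3; 2 * p]%N ++ b.
Proof.
apply: (@sorted_prefix _ _ _ (2 * p)); rewrite ?exponents_sorted //=.
  by lia.
move=> n; rewrite mem_exponents_odd_add2; apply/idP/andP => [nr|].
  rewrite !inE in nr.
  case/or4P: nr => [| | |/or4P[]] /eqP->; (split; [apply/orP|lia]).
  - by left; apply/mem_posP; exists 0%N, 0%N; split; lia.
  - by right; apply/mem_negP; exists 0%N, 0%N; split; lia.
  - by left; apply/mem_posP; exists 1%N, 0%N; split; lia.
  - by right; apply/mem_negP; exists 1%N, 0%N; split; lia.
  - by left; apply/mem_posP; exists 0%N, 1%N; split; lia.
  - by right; apply/mem_negP; exists 0%N, 1%N; split; lia.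
  (* The value i = 2 is admissible because m is at least 2. *)
  - by left; apply/mem_posP; exists 2%N, 0%N; split; lia.
(* Both p and p + 2 are at least p, so at most two of them fit into 2 p. *)
have bound i j : (i * p + j * p.+2 <= 2 * p -> (i <= 2) && (j <= 2 - i))%N.
  move=> ijp; have i2 : (i <= 2)%N by nia.
  by rewrite i2; case: i i2 ijp => [|[|[|]]] // _ ijp; nia.
case=> /orP[/mem_posP|/mem_negP] [i [j [_ _ ->]]] np; rewrite !inE.
  have := bound i j np.
  case: i np => [|[|[|]]] //; case: j => [|[|[|]]] // np _; lia.
have := bound i j (ltnW np).
case: i np => [|[|[|]]] //; case: j => [|[|[|]]] // np _; lia.
Qed.

End OddStrands.

(** * Levels of the generators *)

(** Only horizontal steps change the algebraic level, and they never lower it. *)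
Lemma stair_level_alg_homo s i j :
  (i <= j)%N -> (stair_level s i).1 <= (stair_level s j).1.
Proof.
elim: j => [|j IH]; first by rewrite leqn0 => /eqP->.
rewrite leq_eqVlt => /orP[/eqP->//|/IH ij].
by apply: le_trans ij _ => /=; case: ifP => //= _; rewrite lerDl.
Qed.

(** The corner x_(2n) of T(2, p) is reached from (0, m) by n unit steps to the right and n down. *)
Lemma stair_level_ones m n : (n <= m)%N ->
  stair_level (nseq m.*2 1%N) n.*2 = (n%:Z, m%:Z - n%:Z).
Proof.
elim: n => [|n IH] nm; first by rewrite /= sumn_nseq mul1n doubleK subr0.
rewrite doubleS /= odd_double /= IH; last by lia.
by rewrite !nth_nseq !ifT /=; [congr pair; lia | lia | lia].
Qed.

Lemma stair_levels_succ p : (3 <= p)%N ->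
  let s := steps (exponents (alexander p p.+1)) in
  [/\ stair_level s 0 = (0, ((p.-1 * p)./2)%:Z),
      stair_level s 2 = (1, ((p.-1 * p)./2)%:Z - p.-1%:Z)
    & stair_level s 3 = (3, ((p.-1 * p)./2)%:Z - p.-1%:Z)].
Proof.
move=> p3 s; have [b aE] := exponents_succ_prefix p3.
have a_sorted := exponents_sorted (alexander p p.+1).
have sum_s : sumn s = (p.-1 * p)%N.
  rewrite sumn_steps // (sorted_last (M := p.-1 * p) a_sorted).
  - by rewrite aE subn0.
  - rewrite alexander_succ // exponents_sumXB ?alexander_succ_uniq // mem_cat.
    by apply/orP; left; apply/mem_progression; exists p.-1; lia.
  - exact: le_exponents_succ.
pose r := [:: 0; 1; p; p.+2; 2 * p]%N.
have nth_s i : (i < 4)%N -> nth 0%N s i = (nth 0 r i.+1 - nth 0 r i)%N.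
  by move=> i4; rewrite /s aE nth_steps_cat.
rewrite /= sum_s !nth_s //=; split=> //; congr pair; lia.
Qed.

Lemma stair_levels_odd_add2 m p : (2 <= m)%N -> p = m.*2.+1 ->
  let s := steps (exponents (alexander p p.+2)) in
  let g := (m * m.+1).*2%:Z in
  [/\ stair_level s 4 = (2, g - p%:Z), stair_level s 5 = (3, g - p%:Z)
    & stair_level s 6 = (3, g - p%:Z - (p%:Z - 3))].
Proof.
move=> m2 pE s g; have [b aE] := exponents_odd_add2_prefix m2 pE.
have a_sorted := exponents_sorted (alexander p p.+2).
have sum_s : (sumn s)./2 = (m * m.+1).*2.
  by rewrite sumn_steps // (last_exponents_odd_add2 m2 pE) aE subn0 doubleK.
pose r := [:: 0; 1; p; p.+1; p.+2; p.+3; 2 * p]%N.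
have nth_s i : (i < 6)%N -> nth 0%N s i = (nth 0 r i.+1 - nth 0 r i)%N.
  by move=> i6; rewrite /s aE nth_steps_cat.
rewrite /= sum_s !nth_s //= /g; split=> //; congr pair; lia.
Qed.

Theorem theorem1p2 (p : nat) (hp : odd p) (hp5 : (5 <= p)%N) :
  ~ stably_equiv (CFK_torus p p.+2) (tensor (CFK_torus 2 p) (CFK_torus p p.+1)).
Proof.
pose m := p./2; have pE : p = m.*2.+1 by rewrite /m; lia.
have m2 : (2 <= m)%N by lia.
rewrite /CFK_torus (steps_2_odd pE).
have p3 : (3 <= p)%N by lia.
have [l4 l5 l6] := stair_levels_odd_add2 m2 pE.
have [k0 k2 k3] := stair_levels_succ p3.
(* The genera m of T(2, p) and m p of T(p, p + 1) add up to g = 2 m (m + 1), so both complexes start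
   at the same level. *)
have g2 : (p.-1 * p)./2 = (m * p)%N by rewrite -[RHS]doubleK; congr half; nia.
rewrite g2 in k0 k2 k3.
have ones i : (i <= size (nseq m.*2 1))%N -> ~~ odd i ->
    exists2 n, (n <= m)%N & stair_level (nseq m.*2 1%N) i = (n%:Z, m%:Z - n%:Z).
  rewrite size_nseq => im oi; have nm : (i./2 <= m)%N by lia.
  by exists i./2 => //; rewrite -(stair_level_ones nm) even_halfK.
apply: (@not_stably_equiv_stair _ _ _ 5 3) => //.
- by rewrite (size_steps_odd_add2 m2 pE) odd_double.
- by rewrite size_nseq odd_double.
- by rewrite (size_steps_succ p3) odd_double.
- by rewrite (size_steps_odd_add2 m2 pE); nia.
(* From y_3 on the algebraic level is at least 3, but that of x_4 is 2. *)
- move=> i j im _ oi _; rewrite ltnNge -[5.-1]/4%N l4 => /andP[aE _].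
  apply/negP => j3.
  have := stair_level_alg_homo (steps (exponents (alexander p p.+1))) j3.
  have [n _ nE] := ones i im oi.
  by rewrite k3; move: aE; rewrite nE /=; lia.
- move=> i j im _ oi oj; rewrite l6 ltnNge => /andP[].
  have [n _ ->] := ones i im oi.
  move=> aE xE; apply/negP => j3.
  have [jE|jE] : j = 0%N \/ j = 2%N.
  - by move: j j3 oj {aE xE} => [|[|[|[|]]]] //; auto.
  (* The level is (n, g - n), so n <= 3 and n >= 2 p - 3. *)
  - by move: aE xE; rewrite jE k0 /=; nia.
  (* The level is (n + 1, g - n - p + 1), so n <= 2 and n >= p - 2, a contradiction as p >= 5. *)
  - by move: aE xE; rewrite jE k2 /=; nia.
- move=> i im oi; rewrite /level_le l5 k3.
  (* The level is (n + 3, g - n - p + 1): the first coordinate forces n = 0, and then the second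
     exceeds g - p by 1. *)
  have [n _ ->] := ones i im oi; apply/negP => /andP[/=]; nia.
Qed.
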